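(* For any prime $p$, we have, for each $i=1,2,3,\dots,p-1$, $$\lim_{m \to \infty} \frac{\sum_{k=1}^m \phi(pk-i)}{(pm)^2} =\frac{3p}{(p^{2}-1)\pi^2}.$$
   Context: $\phi$ denotes Euler's totient function: $\phi(n)$ is the number of positive integers not exceeding $n$ that are relatively prime to $n$ (so $\phi(1)=1$). The limit is over positive integers $m$. *)

(* Defs.v *)
From mathcomp Require Import all_boot all_order all_algebra.
From mathcomp Require Import all_classical all_reals all_analysis.

(* Main.v *)
Require Import Defs.
From mathcomp Require Import all_boot all_order all_algebra.
From mathcomp Require Import all_solvable.
From mathcomp Require Import all_classical all_reals all_analysis.
From mathcomp Require Import ring lra zify.
Import Order.TTheory GRing.Theory Num.Theory.
Import numFieldNormedType.Exports.

Local Open Scope classical_set_scope.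
Local Open Scope ring_scope.

(** Write [F_a(n)] for the sum of the totients of the [k <= n] congruent to [a]
    mod [p]. Summing [k = \sum_(d %| k) totient (k / d)] over the [k <= n] in an
    invertible class [a] gives
    [\sum_(d <= n, p does not divide d) F_(a / d)(n / d) = T_a(n)], where [T_a(n)],
    the sum of the [k <= n] in the class [a], is [n ^+ 2 / (2 * p) + O(n)]
    ([sum_totient_class_sum], [class_sum_natr]). If every [F_a(n)] behaves like
    [C * n ^+ 2], this forces [C * z = 1 / (2 * p)], where [z] is the sum of
    [1 / d ^+ 2] over the [d] prime to [p], namely
    [pi ^+ 2 / 6 * (1 - 1 / p ^+ 2)].

    That [F_a(n)] does behave like this follows without Moebius inversion.
    Subtracting [C * (n / d) ^+ 2] from each term of the identity expresses the
    error [D_a(n) = F_a(n) - C * n ^+ 2] as a quantity that is [o(n ^+ 2)]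
    uniformly in [a] ([class_sum_sub_divn_sqr]) minus the [D_(a / d)(n / d)] with
    [d >= 2]. A bound [A * n ^+ 2 + O(1)] on all the errors is therefore
    multiplied by at most [\sum_(d >= 2) 1 / d ^+ 2 <= 3 / 4], up to lower-order
    terms, and iterating makes the coefficient of [n ^+ 2] arbitrarily small
    ([totient_class_sum_contract], [totient_class_sum_asymp]). The classes have
    to be treated together, since [F_a] is expressed through the other classes.

    The sum of [1 / d ^+ 2] is computed from
    [1 / sin x ^+ 2 + 1 / sin (pi / 2 - x) ^+ 2 = 4 / sin (2 * x) ^+ 2]: iterated
    from [x = pi / 4], it evaluates the sum of the inverse squared sines of the
    odd multiples of [pi / 2 ^+ n.+2] below [pi / 2], and comparing [sin x] with
    [x] gives the sum of the inverse odd squares, [pi ^+ 2 / 8]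
    ([sum_inv_sin2], [sum_odd_inv2_bounds], [cvg_sum_inv2]). *)

(** * Inverse squares of sines at odd multiples of a binary fraction of pi *)

Lemma ger0_sin_le (R : realType) (x : R) : 0 <= x -> sin x <= x.
Proof.
move=> x0; have [c _] := @MVT_segment R sin cos 0 x x0
  (fun y _ => is_derive_sin y)
  (continuous_subspaceT (@continuous_sin R)).
by rewrite sin0 !subr0 => ->; rewrite ler_piMl ?cos_le1.
Qed.

Lemma ger0_le_tan (R : realType) (x : R) : 0 <= x < pi / 2 -> x <= tan x.
Proof.
move=> /andP[x0 xpi].
have cosgt0 y : 0 <= y -> y <= x -> 0 < cos y.
  move=> y0 yx; apply: cos_gt0_pihalf; have := pi_gt0 R => ?.
  by apply/andP; split; lra.
have [||c cx] := @MVT_segment R tan (fun y => (cos y) ^- 2) 0 x x0.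
- move=> y /itvP yx; apply: is_derive_tan.
  by rewrite gt_eqF // cosgt0 // ?yx // ltW // yx.
- apply/continuous_in_subspaceT => y; rewrite mem_setE => /itvP yx.
  by apply: continuous_tan; rewrite gt_eqF // cosgt0 // ?yx // ltW // yx.
have c0 : 0 < cos c by move/itvP: cx => cx; rewrite cosgt0 // ?cx.
rewrite tan0 !subr0 => ->; rewrite ler_peMl // invf_ge1 ?exprn_gt0 //.
Qed.

(** This is [sin x <= x <= tan x], with the cosecant squared written as one
    plus the cotangent squared. *)
Lemma inv_sin2_bounds (R : realType) (x : R) : 0 < x < pi / 2 ->
  (x ^+ 2)^-1 <= (sin x ^+ 2)^-1 <= (x ^+ 2)^-1 + 1.
Proof.
move=> /andP[x0 xpi].
have s0 : 0 < sin x by rewrite sin_gt0_pihalf ?x0.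
have c0 : 0 < cos x.
  by apply: cos_gt0_pihalf; rewrite xpi andbT; have := pi_gt0 R => ?; lra.
apply/andP; split.
  rewrite lef_pV2 ?posrE ?exprn_gt0 // ler_pXn2r ?nnegrE ?(ltW s0) ?(ltW x0) //.
  exact/ger0_sin_le/ltW.
have -> : (sin x ^+ 2)^-1 = (tan x ^+ 2)^-1 + 1.
  by rewrite /tan expr_div_n invf_div cos2sin2; field; rewrite gt_eqF.
have xt : x <= tan x by rewrite ger0_le_tan // xpi ltW.
rewrite lerD2r lef_pV2 ?posrE ?exprn_gt0 ?(lt_le_trans x0) //.
by rewrite ler_pXn2r // nnegrE ltW // (lt_le_trans x0).
Qed.

Lemma inv_sin2_double (R : realType) (x : R) : 0 < x < pi / 2 ->
  (sin x ^+ 2)^-1 + (sin (pi / 2 - x) ^+ 2)^-1 = 4 * (sin (x + x) ^+ 2)^-1.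
Proof.
move=> /andP[x0 xpi].
have s0 : 0 < sin x by rewrite sin_gt0_pihalf ?x0.
have c0 : 0 < cos x.
  by apply: cos_gt0_pihalf; rewrite xpi andbT; have := pi_gt0 R => ?; lra.
rewrite sinB sin_pihalf cos_pihalf mul1r mul0r subr0.
have -> : sin (x + x) = 2 * (sin x * cos x) by rewrite sinD; ring.
transitivity ((cos x ^+ 2 + sin x ^+ 2) / (sin x ^+ 2 * cos x ^+ 2)).
  by field; rewrite !gt_eqF.
by rewrite cos2Dsin2; field; rewrite !gt_eqF.
Qed.

(** Halving the angle replaces each term by the pair of terms at [x] and
    [pi / 2 - x], which multiplies the sum by 4. *)
Lemma sum_inv_sin2 (R : realType) (n : nat) :
  \sum_(0 <= k < 2 ^ n) (sin ((2 * k + 1)%:R * pi / 2 ^+ n.+2) ^+ 2)^-1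
  = 2 * 4 ^+ n :> R.
Proof.
elim: n => [|n IHn].
  rewrite expn0 big_nat1 expr0 mulr1.
  have := @inv_sin2_double R (pi / 4).
  have -> : pi / 2 - pi / 4 = pi / 4 :> R by lra.
  have -> : pi / 4 + pi / 4 = pi / 2 :> R by lra.
  have -> : (2 * 0 + 1)%:R * pi / 2 ^+ 2 = pi / 4 :> R.
    by rewrite muln0 add0n mul1r -natrX.
  rewrite sin_pihalf expr1n invr1 => H.
  have := pi_gt0 R => ?.
  suff : 0 < (pi / 4 : R) < pi / 2 by move/H; lra.
  by apply/andP; split; lra.
(* Pair each angle of the first half with its complement, found in the
   reversed second half. *)
rewrite [4 ^+ _]exprS mulrCA -IHn expnS mul2n -addnn.
rewrite (@big_cat_nat _ _ _ (2 ^ n)%N) ?leq_addr //=.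
rewrite -{2}[(2 ^ n)%N]add0n big_addn addnK [X in _ + X = _]big_nat_rev /= add0n.
rewrite -big_split /= mulr_sumr; apply: eq_big_nat => k /andP[_ kn].
set x : R := (2 * k + 1)%:R * pi / 2 ^+ n.+3.
have e0 : 0 < 2 ^+ n.+3 :> R by rewrite exprn_gt0.
have -> : (2 * (2 ^ n - k.+1 + 2 ^ n) + 1)%:R * pi / 2 ^+ n.+3 = pi / 2 - x.
  have -> : (2 * (2 ^ n - k.+1 + 2 ^ n) + 1)%N = (2 ^ n.+2 - (2 * k + 1))%N.
    by rewrite !expnS; lia.
  rewrite natrB; last by rewrite !expnS; lia.
  by rewrite natrX /x [2 ^+ n.+3]exprS; field; rewrite expf_neq0.
have -> : (2 * k + 1)%:R * pi / 2 ^+ n.+2 = x + x.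
  by rewrite /x [2 ^+ n.+3]exprS; field; rewrite expf_neq0.
apply: inv_sin2_double; apply/andP; split.
  by rewrite /x divr_gt0 // mulr_gt0 ?pi_gt0 // ltr0n addn1.
rewrite /x mulrAC mulrC; rewrite ltr_pM2l ?pi_gt0 //.
rewrite ltr_pdivrMr // exprS mulKf // -natrX ltr_nat !expnS; lia.
Qed.

(** The gap between the bounds comes from the [+ 1] in [inv_sin2_bounds], counted
    [2 ^ n] times against a total of [2 * 4 ^+ n]. *)
Lemma sum_odd_inv2_bounds (R : realType) (n : nat) :
  pi ^+ 2 / 8 - pi ^+ 2 / 16 * 2^-1 ^+ n
    <= (\sum_(0 <= k < 2 ^ n) ((2 * k + 1)%:R ^+ 2)^-1 : R) <= pi ^+ 2 / 8.
Proof.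
set S := \sum_(_ <= k < _) _.
have pi0 := pi_gt0 R; have pi_neq0 : pi != 0 :> R by rewrite gt_eqF.
have e0 : 0 < 2 ^+ n :> R by rewrite exprn_gt0.
have E k : ((((2 * k + 1)%:R * pi / 2 ^+ n.+2) ^+ 2)^-1 =
    16 * 4 ^+ n / pi ^+ 2 * ((2 * k + 1)%:R ^+ 2)^-1 :> R)%R.
  have k0 : (2 * k + 1)%:R != 0 :> R by rewrite pnatr_eq0 addn1.
  have -> : 4 ^+ n = (2 ^+ n) ^+ 2 :> R.
    by rewrite exprAC; congr (_ ^+ _); rewrite -natrX.
  move: (2 * k + 1)%:R k0 (pi) pi_neq0 => y y0 w w0.
  by rewrite !exprS; field; rewrite y0 w0 gt_eqF.
have B k : (k < 2 ^ n)%N -> 0 < ((2 * k + 1)%:R * pi / 2 ^+ n.+2 : R) < pi / 2.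
  move=> kn; apply/andP; split.
    by rewrite divr_gt0 ?exprn_gt0 // mulr_gt0 // ltr0n addn1.
  rewrite mulrAC mulrC ltr_pM2l // ltr_pdivrMr ?exprn_gt0 //.
  by rewrite exprS mulKf // -natrX ltr_nat !expnS; lia.
have lo : 16 * 4 ^+ n / pi ^+ 2 * S <= 2 * 4 ^+ n.
  rewrite -sum_inv_sin2 mulr_sumr; apply: ler_sum_nat => k /andP[_ kn].
  by rewrite -E; case/andP: (inv_sin2_bounds _ _ (B _ kn)).
have up : 2 * 4 ^+ n <= 16 * 4 ^+ n / pi ^+ 2 * S + 2 ^+ n.
  have -> : 2 ^+ n = \sum_(0 <= k < 2 ^ n) 1 :> R.
    by rewrite big_const_nat subn0 iter_addr addr0 -natrX.
  rewrite -sum_inv_sin2 mulr_sumr -big_split; apply: ler_sum_nat => k /andP[_ kn].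
  by rewrite /= -E; case/andP: (inv_sin2_bounds _ _ (B _ kn)).
have f0 : 0 < 4 ^+ n :> R by rewrite exprn_gt0.
have c0 : 0 < 16 * 4 ^+ n / pi ^+ 2 :> R.
  by rewrite divr_gt0 ?mulr_gt0 ?exprn_gt0.
have E8 : 16 * 4 ^+ n / pi ^+ 2 * (pi ^+ 2 / 8) = 2 * 4 ^+ n :> R.
  by move: (pi) pi_neq0 => w w0; field.
have E16 : 16 * 4 ^+ n / pi ^+ 2 * (pi ^+ 2 / 16 * 2^-1 ^+ n) = 2 ^+ n :> R.
  have -> : 4 ^+ n = 2 ^+ n * 2 ^+ n :> R by rewrite -exprMn -natrM.
  move: (pi) pi_neq0 => w w0.
  by rewrite exprVn; field; rewrite w0 gt_eqF.
apply/andP; split; rewrite -(ler_pM2l c0).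
  by rewrite mulrBr E8 E16 lerBlDr.
by rewrite E8.
Qed.

(** * The sum of the inverse squares *)

Definition sum_inv2 (R : realType) (n : nat) : R :=
  \sum_(1 <= d < n.+1) (d%:R ^+ 2)^-1.
Arguments sum_inv2 {R} n.

Lemma sum_inv2S (R : realType) (n : nat) :
  sum_inv2 n.+1 = sum_inv2 n + (n.+1%:R ^+ 2)^-1 :> R.
Proof. by rewrite /sum_inv2 big_nat_recr. Qed.

Lemma sum_inv2_double (R : realType) (n : nat) :
  sum_inv2 (2 * n) =
  \sum_(0 <= k < n) ((2 * k + 1)%:R ^+ 2)^-1 + sum_inv2 n / 4 :> R.
Proof.
elim: n => [|n IHn]; first by rewrite muln0 /sum_inv2 !big_geq ?mul0r ?addr0.
have -> : (2 * n.+1)%N = (2 * n).+2 by lia.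
rewrite !sum_inv2S IHn big_nat_recr //=.
have -> : (2 * n).+1 = (2 * n + 1)%N by lia.
have -> : (2 * n + 1).+1 = (2 * n.+1)%N by lia.
rewrite natrM; have : n.+1%:R != 0 :> R by rewrite pnatr_eq0.
move: n.+1%:R (_ ^- 2) => y z y0; by field.
Qed.

Lemma sum_inv2_homo (R : realType) :
  {homo @sum_inv2 R : m n / (m <= n)%N >-> m <= n}.
Proof.
apply: homo_leq => [//|x y z|n]; first exact: le_trans.
by rewrite sum_inv2S lerDl invr_ge0 exprn_ge0.
Qed.

(** The terms are compared with the telescoping [1 / (d - 1) - 1 / d], except
    for [d <= 2]: the exact value [1 / 4] of the second term is what brings the
    constant below 2. *)
Lemma sum_inv2_le (R : realType) (n : nat) : sum_inv2 n <= 7 / 4 :> R.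
Proof.
case: n => [|n]; first by rewrite /sum_inv2 big_geq //; lra.
case: n => [|n]; first by rewrite /sum_inv2 big_nat1 expr1n invr1; lra.
suff : sum_inv2 n.+2 <= 7 / 4 - n.+2%:R^-1 :> R.
  by move/le_trans; apply; rewrite gerBl invr_ge0.
elim: n => [|n IHn].
  by rewrite !sum_inv2S /sum_inv2 big_geq //; lra.
rewrite sum_inv2S -[n.+3]addn1 natrD; apply: le_trans (lerD IHn (lexx _)) _.
have : 0 < n.+2%:R :> R by rewrite ltr0n.
move: n.+2%:R => x x0.
rewrite -subr_ge0.
have -> : 7 / 4 - (x + 1)^-1 - (7 / 4 - x^-1 + (x + 1) ^- 2) =
  (x * (x + 1) ^+ 2)^-1.
  field; rewrite ?gt_eqF //; lra.
by rewrite invr_ge0 mulr_ge0 ?exprn_ge0; lra.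
Qed.

(** The sequence converges by monotonicity; the limit [z] satisfies
    [z - z / 4 = pi ^+ 2 / 8] by splitting off the even terms. *)
Lemma cvg_sum_inv2 (R : realType) :
  @sum_inv2 R n @[n --> \oo] --> (pi ^+ 2 / 6 : R).
Proof.
have cz : cvgn (@sum_inv2 R).
  apply: nondecreasing_is_cvgn; first exact: sum_inv2_homo.
  by exists (7 / 4) => _ [n _ <-]; exact: sum_inv2_le.
set z := limn (@sum_inv2 R).
have pow_oo : (2 ^ n)%N @[n --> \oo] --> \oo.
  move=> A [N _ NA]; exists N => // n Nn; apply: NA => /=.
  exact: leq_trans Nn (ltnW (ltn_expl n _)).
have c1 : @sum_inv2 R (2 ^ n)%N @[n --> \oo] --> z.
  exact: (cvg_comp _ _ pow_oo cz).
have c2 : @sum_inv2 R (2 * 2 ^ n)%N @[n --> \oo] --> z.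
  by apply: (cvg_comp _ _ (cvg_comp _ _ pow_oo (cvg_mulnl 2 _)) cz).
have c3 : @sum_inv2 R (2 * 2 ^ n)%N - sum_inv2 (2 ^ n)%N / 4
    @[n --> \oo] --> z - z / 4.
  by apply: cvgB => //; apply: cvgMl.
have c4 : @sum_inv2 R (2 * 2 ^ n)%N - sum_inv2 (2 ^ n)%N / 4
    @[n --> \oo] --> pi ^+ 2 / 8.
  apply: (@squeeze_cvgr _ _ _ _
    (fun n => pi ^+ 2 / 8 - pi ^+ 2 / 16 * 2^-1 ^+ n) (fun=> pi ^+ 2 / 8)).
  - by near=> n; rewrite sum_inv2_double addrK sum_odd_inv2_bounds.
  - rewrite -[X in _ --> X]subr0 -[X in _ - X](mulr0 (pi ^+ 2 / 16)).
    apply: cvgB; first exact: cvg_cst.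
    apply: cvgMr; apply: cvg_expr; rewrite ger0_norm; lra.
  - exact: cvg_cst.
have e : z - z / 4 = pi ^+ 2 / 8 by exact: cvg_unique c3 c4.
have -> : pi ^+ 2 / 6 = z by move: (pi ^+ 2) e => w e; lra.
exact: cz.
Unshelve. all: by end_near.
Qed.

Definition sum_inv2_coprime (R : realType) (p n : nat) : R :=
  \sum_(1 <= d < n.+1 | ~~ (p %| d)%N) (d%:R ^+ 2)^-1.
Arguments sum_inv2_coprime {R} p n.

Lemma sum_inv2_coprimeE (R : realType) (p n : nat) : (0 < p)%N ->
  sum_inv2_coprime p n = sum_inv2 n - sum_inv2 (n %/ p) / p%:R ^+ 2 :> R.
Proof.
move=> p0; elim: n => [|n IHn].
  by rewrite div0n /sum_inv2_coprime /sum_inv2 !big_geq // mul0r subr0.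
rewrite sum_inv2S /sum_inv2_coprime big_mkcond big_nat_recr //= -big_mkcond /=.
rewrite -/(sum_inv2_coprime p n) IHn divnS //.
have [dvd|_] := boolP (p %| n.+1)%N; last by rewrite /= add0n addrAC.
rewrite /= add1n sum_inv2S.
have -> : (n %/ p).+1 = (n.+1 %/ p)%N by rewrite divnS // dvd add1n.
have /natr_div -> : (p %| n.+1)%N := dvd.
- have : n.+1%:R != 0 :> R by rewrite pnatr_eq0.
  have : p%:R != 0 :> R by rewrite pnatr_eq0 -lt0n.
  by move: n.+1%:R p%:R => x y y0 x0; field; rewrite y0 x0.
- by rewrite unitfE pnatr_eq0 -lt0n.
Qed.

Lemma sum_inv2_coprime_le (R : realType) (p n : nat) :
  sum_inv2_coprime p n <= sum_inv2 n :> R.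
Proof.
rewrite /sum_inv2_coprime big_mkcond /= ler_sum_nat // => d _.
by case: ifP => // _; rewrite invr_ge0 exprn_ge0.
Qed.

Lemma sum_inv2_coprime_ge0 (R : realType) (p n : nat) :
  0 <= sum_inv2_coprime p n :> R.
Proof. by apply: sumr_ge0 => d _; rewrite invr_ge0 exprn_ge0. Qed.

(** The product of [pi ^+ 2 / 6] with the inverse of its Euler factor at [p]. *)
Definition zeta2_coprime (R : realType) (p : nat) : R :=
  pi ^+ 2 / 6 * (1 - (p%:R ^+ 2)^-1).

Lemma cvg_sum_inv2_coprime (R : realType) (p : nat) : (0 < p)%N ->
  @sum_inv2_coprime R p n @[n --> \oo] --> zeta2_coprime R p.
Proof.
move=> p0; rewrite (_ : sum_inv2_coprime p = fun n =>
  sum_inv2 n - sum_inv2 (n %/ p) / p%:R ^+ 2); last first.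
  by apply/funext => n; exact: sum_inv2_coprimeE.
rewrite /zeta2_coprime mulrBr mulr1; apply: cvgB; first exact: cvg_sum_inv2.
by apply: cvgMl; apply: (cvg_comp _ _ (cvg_divnr _ p0) (cvg_sum_inv2 R)).
Qed.

Lemma zeta2_coprime_gt0 (R : realType) (p : nat) : (1 < p)%N ->
  0 < zeta2_coprime R p.
Proof.
move=> p1; rewrite /zeta2_coprime mulr_gt0 ?divr_gt0 ?exprn_gt0 ?pi_gt0 //.
by rewrite subr_gt0 invf_lt1 ?exprn_gt0 ?exprn_egt1 ?ltr1n ?ltr0n // ltnW.
Qed.

(** * Sums over a residue class *)

Lemma Fp_natr_eq (p m n : nat) : prime p ->
  (m%:R == n%:R :> 'F_p) = (m == n %[mod p]).
Proof. by move=> pp; rewrite -val_eqE /= !val_Fp_nat. Qed.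

Lemma Fp_natr_eq0 (p n : nat) : prime p ->
  (n%:R == 0 :> 'F_p) = (p %| n)%N.
Proof. by move=> pp; rewrite (dvdn_pcharf (pchar_Fp pp)). Qed.

Lemma Fp_natr_in_block (p n : nat) (a : 'F_p) : prime p ->
  exists2 k : nat, (n < k <= n + p)%N & k%:R = a :> 'F_p.
Proof.
move=> pp; pose b : 'F_p := a - n.+1%:R.
have bp : (b < p)%N by rewrite -[X in (_ < X)%N](Fp_cast pp) ltn_ord.
exists (n.+1 + b)%N; first by lia.
by rewrite natrD natr_Zp /b addrC subrK.
Qed.

Definition class_sum (R : realType) (p : nat) (a : 'F_p) (f : nat -> R)
    (n : nat) : R :=
  \sum_(1 <= k < n.+1 | k%:R == a) f k.
Arguments class_sum {R p} a f n.

Lemma class_sum_block (R : realType) (p : nat) (a : 'F_p) (f : nat -> R)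
    (n k : nat) : prime p -> (n < k <= n + p)%N -> k%:R = a ->
  class_sum a f (n + p) = class_sum a f n + f k.
Proof.
move=> pp kn ka; rewrite /class_sum.
rewrite (@big_cat_nat _ _ _ n.+1) //=; last by lia.
congr (_ + _); rewrite big_mkcond (bigD1_seq k) ?iota_uniq //=; last first.
  by rewrite mem_index_iota; lia.
rewrite ka eqxx big1_seq ?addr0 // => j /andP[jk].
rewrite mem_index_iota => jn; case: ifP => // ja; exfalso; move: ja.
rewrite -ka Fp_natr_eq //.
wlog jk' : j k {ka} kn jn jk / (k < j)%N => [H|].
  have := jk; rewrite neq_ltn => /orP[jk'|kj]; last exact: H.
  rewrite eq_sym; apply: H => //; last by rewrite eq_sym.
rewrite eqn_mod_dvd ?(ltnW jk') // => /dvdn_leq; lia.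
Qed.

Lemma class_sum_bounds (R : realType) (p : nat) (a : 'F_p) (f : nat -> R)
    (n : nat) : (forall k, 0 <= f k <= k%:R) ->
  0 <= class_sum a f n <= n%:R ^+ 2.
Proof.
move=> fk; apply/andP; split.
  by apply: sumr_ge0 => k _; case/andP: (fk k).
rewrite /class_sum big_mkcond /=.
have -> : n%:R ^+ 2 = \sum_(1 <= k < n.+1) n%:R :> R.
  by rewrite sumr_const_nat subn1 -[RHS]mulr_natr.
apply: ler_sum_nat => k /andP[_ kn]; case/andP: (fk k) => _ fkk.
by case: ifP => // _; apply: le_trans fkk _; rewrite ler_nat.
Qed.

(** One block of [p] consecutive integers adds to both sides the same amount
    up to an error [p / 2], whatever the class [a]. *)
Lemma class_sum_natr (R : realType) (p : nat) (a : 'F_p) (n : nat) :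
  prime p ->
  `|class_sum a (fun k => k%:R) n - n%:R ^+ 2 / (2 * p%:R)|
    <= n%:R + p%:R ^+ 2 :> R.
Proof.
move=> pp; have p0 := prime_gt0 pp.
have pR : 1 <= p%:R :> R by rewrite ler1n.
elim/ltn_ind: n => n IHn; have [np|pn] := ltnP n p.
  have /andP[T0 T1] : 0 <= class_sum a (fun k => k%:R : R) n <= n%:R ^+ 2.
    by apply: class_sum_bounds => k; rewrite ler0n lexx.
  have nn : n%:R ^+ 2 <= p%:R ^+ 2 :> R.
    by rewrite ler_pXn2r ?nnegrE // ler_nat ltnW.
  have n0 : 0 <= n%:R ^+ 2 / (2 * p%:R) :> R.
    by rewrite divr_ge0 ?exprn_ge0 ?mulr_ge0.
  have n1 : n%:R ^+ 2 / (2 * p%:R) <= n%:R ^+ 2 :> R.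
    by rewrite ler_piMr ?exprn_ge0 // invf_le1 //; lra.
  have nR : 0 <= n%:R :> R by [].
  by rewrite ler_norml; apply/andP; split; lra.
have [m nE] : exists m, n = (m + p)%N by exists (n - p)%N; rewrite subnK.
have [k /[dup] kmp /andP[mk kp] ka] := Fp_natr_in_block p m a pp.
have mn : (m < n)%N by rewrite nE -[X in (X < _)%N]addn0 ltn_add2l.
have := IHn m mn; rewrite nE (class_sum_block _ _ _ _ _ _ pp kmp ka) natrD.
have -> : (m%:R + p%:R) ^+ 2 / (2 * p%:R) =
  m%:R ^+ 2 / (2 * p%:R) + m%:R + p%:R / 2 :> R by field; lra.
have mk' : m%:R <= k%:R :> R by rewrite ler_nat ltnW.
have kp' : k%:R <= m%:R + p%:R :> R by rewrite -natrD ler_nat.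
by rewrite !ler_norml => /andP[lo up]; apply/andP; split; lra.
Qed.

(** * The divisor sum of the totient over a residue class *)

(** The Dirichlet hyperbola: pairs [(d, e)] with [d * e <= n], grouped by [d]
    or by the product [d * e]. *)
Lemma sum_pairs_by_product (R : realType) (g : nat -> nat -> R) (n : nat) :
  \sum_(1 <= d < n.+1) \sum_(1 <= e < (n %/ d).+1) g d e =
  \sum_(1 <= k < n.+1) \sum_(1 <= d < k.+1 | (d %| k)%N) g d (k %/ d)%N.
Proof.
elim: n => [|n IHn]; first by rewrite !big_geq.
rewrite [RHS]big_nat_recr //= -IHn.
(* The row [d = n.+1] is empty at stage [n]. *)
have -> : \sum_(1 <= d < n.+1) \sum_(1 <= e < (n %/ d).+1) g d e =
  \sum_(1 <= d < n.+2) \sum_(1 <= e < (n %/ d).+1) g d e.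
  by rewrite [RHS]big_nat_recr //= divn_small // [X in _ + X]big_geq ?addr0.
rewrite [X in _ = _ + X]big_mkcond -big_split; apply: eq_big_nat => d /andP[d0 _].
rewrite divnS //; case: ifP => dvd /=; last by rewrite addr0.
by rewrite big_nat_recr //= dvd.
Qed.

Lemma sum_totient_divn (k : nat) : (0 < k)%N ->
  (\sum_(1 <= d < k.+1 | d %| k) totient (k %/ d) = k)%N.
Proof.
move=> k0; rewrite -[RHS]sum_totient_dvd.
transitivity (\sum_(d < k.+1 | d %| k) totient (k %/ d))%N.
  rewrite -(big_mkord (fun d => d %| k)%N (fun d => totient (k %/ d)%N)).
  by rewrite [RHS]big_ltn_cond // dvd0n gtn_eqF.
have inE (d : 'I_k.+1) : (inord (k %/ d) : 'I_k.+1) = (k %/ d)%N :> nat.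
  by rewrite inordK // ltnS leq_div.
have divK d : (d %| k)%N -> (k %/ (k %/ d))%N = d.
  by move=> dk; rewrite divnA // mulKn.
rewrite (reindex_onto (fun d : 'I_k.+1 => inord (k %/ d))
  (fun d : 'I_k.+1 => inord (k %/ d))) /=; last first.
  by move=> d dk; apply: val_inj; rewrite /= inE inE divK.
have dd (d : 'I_k.+1) : (inord (k %/ (k %/ d)) == d) = (k %/ (k %/ d) == d)%N.
  by rewrite -val_eqE /= inordK // ltnS leq_div.
apply: eq_big => [d|d]; rewrite inE dd.
  apply/andP/idP => [[dk /eqP <-]|dk]; first exact: dvdn_div.
  by rewrite dvdn_div // divK.
by move=> /andP[_ /eqP ->].
Qed.

Definition totient_class_sum (R : realType) (p : nat) (a : 'F_p) (n : nat) : R :=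
  class_sum a (fun k => (totient k)%:R) n.
Arguments totient_class_sum {R p} a n.

(** Sum [k = \sum_(d %| k) totient (k / d)] over the [k <= n] in the class
    [a]. As [a] is invertible, so is every divisor [d] of [k], and [k / d]
    runs through the class [a / d]. *)
Lemma sum_totient_class_sum (R : realType) (p : nat) (a : 'F_p) (n : nat) :
  prime p -> a != 0 ->
  \sum_(1 <= d < n.+1 | ~~ (p %| d)%N) totient_class_sum (a / d%:R) (n %/ d)
  = class_sum a (fun k => k%:R) n :> R.
Proof.
move=> pp a0.
pose g d e : R :=
  if ~~ (p %| d)%N && (e%:R == a / d%:R) then (totient e)%:R else 0.
transitivity (\sum_(1 <= d < n.+1) \sum_(1 <= e < (n %/ d).+1) g d e).
  rewrite big_mkcond; apply: eq_bigr => d _; rewrite /g; case: ifP => _ /=.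
    by rewrite /totient_class_sum /class_sum big_mkcond.
  by rewrite big1.
rewrite sum_pairs_by_product /class_sum [RHS]big_mkcond.
apply: eq_big_nat => k /andP[k0 _]; case: ifP => [/eqP ka|/negbT ka].
  rewrite -[in RHS](sum_totient_divn _ k0) natr_sum; apply: eq_bigr => d dk.
  have d0 : d%:R != 0 :> 'F_p.
    apply: contraNneq a0 => d0.
    by rewrite -ka -(divnK dk) natrM d0 mulr0.
  rewrite /g -Fp_natr_eq0 // d0 -ka -{2}(divnK dk) natrM mulfK //.
  by rewrite eqxx.
apply: big1 => d dk; rewrite /g -Fp_natr_eq0 //; case: ifP => // /andP[d0].
move=> /eqP e; case/eqP: ka.
by rewrite -(divnK dk) natrM e divfK.
Qed.

(** * Decay of the error term *)

(** The floor loses at most [2 * n / d] on [(n / d) ^+ 2]. The harmonic sum is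
    avoided by [2 / d <= del + 1 / (del * d ^+ 2)], whose two parts sum to
    [del * n] and to a bounded quantity. *)
Lemma sum_divn_sqr_asymp (R : realType) (p : nat) (eps : R) :
  (0 < p)%N -> 0 < eps ->
  exists K : R, forall n : nat,
    `|zeta2_coprime R p * n%:R ^+ 2
      - \sum_(1 <= d < n.+1 | ~~ (p %| d)%N) (n %/ d)%:R ^+ 2|
    <= eps * n%:R ^+ 2 + K.
Proof.
move=> p0 eps0; set z := zeta2_coprime R p.
have [del del0 epsE] : exists2 del, 0 < del & eps = 3 * del.
  by exists (eps / 3); [rewrite divr_gt0|field].
have /cvgrPdist_le/(_ del del0)[N _ NZ] := cvg_sum_inv2_coprime R p p0.
exists ((`|z| + 2) * N%:R ^+ 2 + (del ^+ 3)^-1) => n.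
have n0 : 0 <= n%:R :> R by [].
set Q := \sum_(_ <= d < _ | _) _.
have head : `|z * n%:R ^+ 2 - sum_inv2_coprime p n * n%:R ^+ 2|
    <= del * n%:R ^+ 2 + (`|z| + 2) * N%:R ^+ 2.
  rewrite -mulrBl normrM [`|n%:R ^+ 2|]ger0_norm ?exprn_ge0 //.
  have [Nn|nN] := leqP N n.
    apply: le_trans (_ : _ <= del * n%:R ^+ 2) _.
      by rewrite ler_wpM2r ?exprn_ge0 //; exact: NZ.
    by rewrite lerDl mulr_ge0 ?exprn_ge0 // addr_ge0.
  apply: le_trans (_ : _ <= (`|z| + 2) * N%:R ^+ 2) _; last first.
    by rewrite lerDr mulr_ge0 ?exprn_ge0 // ltW.
  apply: ler_pM; rewrite ?exprn_ge0 //.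
    apply: le_trans (ler_normB _ _) _; rewrite lerD2l.
    rewrite ger0_norm ?sum_inv2_coprime_ge0 //.
    apply: le_trans (sum_inv2_coprime_le R p n) _.
    by apply: le_trans (sum_inv2_le R n) _; lra.
  by rewrite ler_pXn2r ?nnegrE // ler_nat ltnW.
have term d : (1 <= d)%N -> 
    0 <= (n%:R ^+ 2 / d%:R ^+ 2 - (n %/ d)%:R ^+ 2 : R)
      <= del * n%:R + n%:R / del * (d%:R ^+ 2)^-1.
  move=> d1; have dR : 0 < d%:R :> R by rewrite ltr0n.
  set q : R := (n %/ d)%:R; set x : R := n%:R / d%:R.
  have q0 : 0 <= q by [].
  have qx : q <= x by rewrite ler_pdivlMr // -natrM ler_nat leq_trunc_div.
  have xq : x <= q + 1.
    by rewrite ler_pdivrMr // /q natr1 -natrM ler_nat ltnW // ltn_ceil.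
  have -> : n%:R ^+ 2 / d%:R ^+ 2 = x ^+ 2 by rewrite expr_div_n.
  apply/andP; split; first by rewrite subr_ge0 ler_pXn2r ?nnegrE // (le_trans q0).
  apply: le_trans (_ : 2 * x <= _); first by nra.
  rewrite -subr_ge0.
  have -> : del * n%:R + n%:R / del / d%:R ^+ 2 - 2 * x =
    n%:R / del * (del - d%:R^-1) ^+ 2.
    by rewrite /x; field; rewrite !gt_eqF.
  by rewrite mulr_ge0 ?sqr_ge0 ?divr_ge0 ?(ltW del0).
have tail : `|sum_inv2_coprime p n * n%:R ^+ 2 - Q|
    <= 2 * del * n%:R ^+ 2 + (del ^+ 3)^-1.
  rewrite mulr_suml -sumrB ger0_norm; last first.
    rewrite big_nat_cond; apply: sumr_ge0 => d /andP[/andP[d1 _] _].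
    by rewrite mulrC; case/andP: (term d d1).
  apply: le_trans (_ : _ <= \sum_(1 <= d < n.+1)
      (del * n%:R + n%:R / del * (d%:R ^+ 2)^-1)) _.
    rewrite big_mkcond; apply: ler_sum_nat => d /andP[d1 _].
    case/andP: (term d d1) => t0 t1; case: ifP => _; first by rewrite mulrC.
    exact: le_trans t0 t1.
  rewrite big_split /= sumr_const_nat subn1 -mulr_sumr -/(sum_inv2 n).
  rewrite -[X in X + _]mulr_natr.
  have : n%:R / del * sum_inv2 n <= n%:R / del * 2.
    rewrite ler_wpM2l ?divr_ge0 ?(ltW del0) //.
    by apply: le_trans (sum_inv2_le R n) _; lra.
  have : 0 <= del * (n%:R - (del ^+ 2)^-1) ^+ 2.
    by rewrite mulr_ge0 ?sqr_ge0 // ltW.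
  have -> : del * (n%:R - (del ^+ 2)^-1) ^+ 2 =
    del * n%:R ^+ 2 - n%:R / del * 2 + (del ^+ 3)^-1.
    by field; rewrite gt_eqF.
  by rewrite -[del * n%:R * n%:R]mulrA -expr2; lra.
rewrite -[X in `|X|](subrKA (sum_inv2_coprime p n * n%:R ^+ 2)).
apply: le_trans (ler_normD _ _) _; apply: le_trans (lerD head tail) _.
rewrite epsE.
by rewrite le_eqVlt; apply/orP; left; apply/eqP; ring.
Qed.

(** Both the natural numbers of the class and the squares of the quotients
    grow like [n ^+ 2]; the constant [(2 * p * zeta2_coprime R p)^-1] is the
    one that makes the two leading terms cancel. *)
Lemma class_sum_sub_divn_sqr (R : realType) (p : nat) (eps : R) :
  prime p -> 0 < eps ->
  exists2 K : R, 0 <= K & forall (a : 'F_p) (n : nat),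
    `|class_sum a (fun k => k%:R) n
      - (2 * p%:R * zeta2_coprime R p)^-1
        * \sum_(1 <= d < n.+1 | ~~ (p %| d)%N) (n %/ d)%:R ^+ 2|
    <= eps * n%:R ^+ 2 + K.
Proof.
move=> pp eps0; have p0 := prime_gt0 pp.
have z0 := zeta2_coprime_gt0 R p (prime_gt1 pp).
set z := zeta2_coprime R p in z0 *; set C := (2 * p%:R * z)^-1.
have pR : 0 < p%:R :> R by rewrite ltr0n.
have C0 : 0 < C by rewrite invr_gt0 mulr_gt0 // mulr_gt0.
have [del del0 epsE] : exists2 del, 0 < del & eps = 2 * del.
  by exists (eps / 2); [rewrite divr_gt0|field].
have [K HK] := @sum_divn_sqr_asymp R p (del / C) p0 (divr_gt0 del0 C0).
have K0 : 0 <= K.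
  by have := le_trans (normr_ge0 _) (HK 0%N); rewrite expr0n mulr0 add0r.
exists (del^-1 + p%:R ^+ 2 + C * K) => [|a n].
  apply: addr_ge0; last by rewrite mulr_ge0 // ltW.
  by rewrite addr_ge0 ?exprn_ge0 // invr_ge0 ltW.
set T := class_sum _ _ _; set Q := \sum_(_ <= d < _ | _) _.
have /= HT : `|T - n%:R ^+ 2 / (2 * p%:R)| <= n%:R + p%:R ^+ 2.
  exact: class_sum_natr.
have HQ := HK n; rewrite -/z -/Q in HQ.
have -> : T - C * Q =
    (T - n%:R ^+ 2 / (2 * p%:R)) + C * (z * n%:R ^+ 2 - Q).
  have -> : n%:R ^+ 2 / (2 * p%:R) = C * z * n%:R ^+ 2.
    by rewrite /C; field; rewrite !gt_eqF.
  ring.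
apply: le_trans (ler_normD _ _) _; rewrite normrM [`|C|]gtr0_norm //.
apply: le_trans (lerD HT (ler_wpM2l (ltW C0) HQ)) _.
have -> : C * (del / C * n%:R ^+ 2 + K) = del * n%:R ^+ 2 + C * K.
  by field; rewrite gt_eqF.
have : 0 <= del * (n%:R - del^-1 / 2) ^+ 2 by rewrite mulr_ge0 ?sqr_ge0 ?ltW.
have -> : del * (n%:R - del^-1 / 2) ^+ 2 = del * n%:R ^+ 2 - n%:R + del^-1 / 4.
  by field; rewrite gt_eqF.
have : 0 < del^-1 by rewrite invr_gt0.
by rewrite epsE; lra.
Qed.

(** The terms with [d >= 2] carry the weights [1 / d ^+ 2], whose sum is at
    most [3 / 4]; this is what makes the bound contract. The rest of [7 / 8] pays
    [A / 16] for the main term and [A / 16] for the linear term [B * n]. *)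
Lemma totient_class_sum_contract (R : realType) (p : nat) (A B : R) :
  let C := (2 * p%:R * zeta2_coprime R p)^-1 in
  prime p -> 0 < A -> 0 <= B ->
  (forall (a : 'F_p) n, a != 0 ->
    `|totient_class_sum a n - C * n%:R ^+ 2| <= A * n%:R ^+ 2 + B) ->
  exists2 B' : R, 0 <= B' & forall (a : 'F_p) n, a != 0 ->
    `|totient_class_sum a n - C * n%:R ^+ 2| <= A * (7 / 8) * n%:R ^+ 2 + B'.
Proof.
move=> C pp A0 B0 HAB.
have [K K0 HK] := class_sum_sub_divn_sqr R p (A / 16) pp (divr_gt0 A0 (ltr0n _ 16)).
(* The constant completes the square in [A / 16 * n ^+ 2 - B * n]. *)
have BA0 : 0 <= 4 * B ^+ 2 / A by rewrite divr_ge0 ?mulr_ge0 ?exprn_ge0 // ltW.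
exists (K + 4 * B ^+ 2 / A) => [|a n a0]; first by rewrite addr_ge0.
case: n => [|n].
  rewrite /totient_class_sum /class_sum big_geq // expr0n /= !mulr0 subr0.
  by rewrite normr0 add0r addr_ge0.
set N := n.+1; pose D (b : 'F_p) n : R := totient_class_sum b n - C * n%:R ^+ 2.
have decomp : D a N =
    (class_sum a (fun k => k%:R) N
     - C * \sum_(1 <= d < N.+1 | ~~ (p %| d)%N) (N %/ d)%:R ^+ 2)
    - \sum_(2 <= d < N.+1 | ~~ (p %| d)%N) D (a / d%:R) (N %/ d)%N.
  apply/eqP; rewrite eq_sym subr_eq eq_sym; apply/eqP.
  rewrite -sum_totient_class_sum // mulr_sumr -sumrB.
  rewrite [RHS]big_ltn_cond //= dvdn1 gtn_eqF ?prime_gt1 //=.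
  by rewrite divr1 divn1.
rewrite -/(D a N) decomp.
apply: le_trans (ler_normB _ _) _.
have head := HK a N; rewrite -/C in head.
have tail : `|\sum_(2 <= d < N.+1 | ~~ (p %| d)%N) D (a / d%:R) (N %/ d)%N|
    <= A * N%:R ^+ 2 * (3 / 4) + B * N%:R.
  apply: le_trans (ler_norm_sum _ _ _) _.
  apply: le_trans (_ : _ <= \sum_(2 <= d < N.+1)
      (A * N%:R ^+ 2 * (d%:R ^+ 2)^-1 + B)) _.
    rewrite big_mkcond; apply: ler_sum_nat => d /andP[d2 _].
    have dR : 0 < d%:R :> R by rewrite ltr0n ltnW.
    case: ifP => pd; last first.
      by rewrite addr_ge0 ?mulr_ge0 ?invr_ge0 ?exprn_ge0 ?(ltW A0).
    apply: le_trans (HAB _ _ _) _.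
      by rewrite mulf_neq0 ?invr_eq0 ?Fp_natr_eq0.
    rewrite lerD2r -mulrA ler_pM2l // -expr_div_n ler_pXn2r ?nnegrE ?divr_ge0 //.
    by rewrite ler_pdivlMr // -natrM ler_nat leq_trunc_div.
  rewrite big_split /= -mulr_sumr sumr_const_nat -[B *+ _]mulr_natr.
  apply: lerD; last by rewrite ler_wpM2l // ler_nat subn2.
  rewrite ler_wpM2l ?mulr_ge0 ?exprn_ge0 ?(ltW A0) //.
  have := sum_inv2_le R N; rewrite /sum_inv2 big_ltn // expr1n invr1; lra.
apply: le_trans (lerD head tail) _.
have : 0 <= A / 16 * (N%:R - 8 * B / A) ^+ 2.
  by rewrite mulr_ge0 ?sqr_ge0 // divr_ge0 // ltW.
have -> : A / 16 * (N%:R - 8 * B / A) ^+ 2 =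
  A / 16 * N%:R ^+ 2 - B * N%:R + 4 * B ^+ 2 / A.
  by field; rewrite gt_eqF.
lra.
Qed.

Lemma totient_class_sum_asymp (R : realType) (p : nat) (eps : R) :
  prime p -> 0 < eps ->
  exists2 B : R, 0 <= B & forall (a : 'F_p) n, a != 0 ->
    `|totient_class_sum a n - (2 * p%:R * zeta2_coprime R p)^-1 * n%:R ^+ 2|
      <= eps * n%:R ^+ 2 + B.
Proof.
move=> pp eps0; set C := (_ * zeta2_coprime R p)^-1.
have C0 : 0 < C.
  rewrite invr_gt0 mulr_gt0 ?zeta2_coprime_gt0 ?prime_gt1 //.
  by rewrite mulr_gt0 // ltr0n prime_gt0.
have H j : exists2 B : R, 0 <= B & forall (a : 'F_p) n, a != 0 ->
    `|totient_class_sum a n - C * n%:R ^+ 2|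
      <= (1 + C) * (7 / 8) ^+ j * n%:R ^+ 2 + B.
  elim: j => [|j [B B0 IH]].
    exists 0 => // a n _; rewrite expr0 mulr1 addr0.
    have /andP[F0 F1] : 0 <= (totient_class_sum a n : R) <= n%:R ^+ 2.
      apply: class_sum_bounds => k.
      rewrite ler0n ler_nat; case: k => // k.
      by rewrite -[X in (_ <= X)%N]sum_totient_dvd (bigD1 ord_max) //= leq_addr.
    have : 0 <= C * n%:R ^+ 2 by rewrite mulr_ge0 ?exprn_ge0 // ltW.
    by rewrite ler_norml => ?; apply/andP; split; lra.
  have [|B' B'0 HB'] := totient_class_sum_contract R p _ B pp _ B0 IH.
    by rewrite mulr_gt0 ?exprn_gt0 // addr_gt0.
  exists B' => // a n a0; rewrite [(7 / 8) ^+ _]exprSr.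
  by rewrite [(1 + C) * (_ * _)]mulrA; exact: HB'.
have cj : (1 + C) * (7 / 8) ^+ j @[j --> \oo] --> (1 + C) * 0.
  by apply: cvgMr; apply: cvg_expr; rewrite ger0_norm; lra.
rewrite mulr0 in cj.
have /cvgrPdist_le/(_ eps eps0)[j _ /(_ j (leqnn j))] := cj.
rewrite /= sub0r normrN => hj.
have [B B0 HB] := H j; exists B => // a n a0.
apply: le_trans (HB a n a0) _; rewrite lerD2r ler_wpM2r ?exprn_ge0 //.
exact: le_trans (ler_norm _) hj.
Qed.

(** The class of [- i] has exactly one element, [p * k - i], among the integers
    in [(p * (k - 1), p * k]]. *)
Lemma class_sum_opp (R : realType) (p i m : nat) (f : nat -> R) :
  prime p -> (i < p)%N ->
  class_sum (- i%:R : 'F_p) f (p * m) = \sum_(1 <= k < m.+1) f (p * k - i)%N.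
Proof.
move=> pp ip; elim: m => [|m IHm].
  by rewrite muln0 /class_sum !big_geq.
rewrite mulnS addnC (class_sum_block _ _ _ _ _ (p * m.+1 - i)) //.
- by rewrite IHm [RHS]big_nat_recr.
- by rewrite mulnS; lia.
rewrite natrB; last by rewrite mulnS; lia.
by rewrite natrM pchar_Fp_0 // mul0r sub0r.
Qed.

Theorem theorem2 (R : realType) (p : nat) (p_prime : prime p)
    (i : nat) (i_range : (1 <= i <= p - 1)%N) :
  ((\sum_(1 <= k < m.+1) (totient (p * k - i))%:R) / (p * m)%:R ^+ 2)
    @[m --> \oo] --> (3 * p%:R / ((p%:R ^+ 2 - 1) * pi ^+ 2) : R).
Proof.
have p1 := prime_gt1 p_prime; have p0 := prime_gt0 p_prime.
have pR : 1 < p%:R :> R by rewrite ltr1n.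
have ip : (i < p)%N by lia.
have i0 : - i%:R != 0 :> 'F_p.
  rewrite oppr_eq0 Fp_natr_eq0 //; apply/negP => /dvdn_leq; lia.
set C := _ / _.
have CE : C = (2 * p%:R * zeta2_coprime R p)^-1.
  have : pi != 0 :> R by rewrite gt_eqF ?pi_gt0.
  rewrite /C /zeta2_coprime; move: (pi) => w w0.
  by field; rewrite w0 /=; apply/and3P; split; nra.
apply/cvgrPdist_le => eps eps0.
have [B B0 HB] := totient_class_sum_asymp R p (eps / 2) p_prime (divr_gt0 eps0 (ltr0n _ 2)).
near=> m.
rewrite -(class_sum_opp _ _ _ _ (fun k => (totient k)%:R)) // distrC -/(totient_class_sum _ _).
have m0 : (0 < m)%N by near: m; exists 1%N.
have x1 : 1 <= (p * m)%:R :> R by rewrite ler1n muln_gt0 p0.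
have mx : m%:R <= (p * m)%:R :> R by rewrite ler_nat leq_pmull.
have Bm : 2 * B / eps < m%:R by near: m; exact: nbhs_infty_gtr.
have := HB _ (p * m)%N i0; rewrite -CE.
move: (totient_class_sum _ _) (p * m)%:R x1 mx => F x x1 mx HF.
have x0 : 0 < x ^+ 2 by rewrite exprn_gt0 // (lt_le_trans ltr01).
have -> : F / x ^+ 2 - C = (F - C * x ^+ 2) / x ^+ 2.
  by field; rewrite gt_eqF // (lt_le_trans ltr01).
rewrite normrM normfV [`|x ^+ 2|]gtr0_norm // ler_pdivrMr //.
apply: le_trans HF _.
suff : B <= eps / 2 * x ^+ 2 by lra.
have : 2 * B < m%:R * eps by rewrite -ltr_pdivrMr.
have : m%:R * eps <= x ^+ 2 * eps.
  by rewrite ler_pM2r // (le_trans mx) // expr2 ler_peMl // (le_trans ler01).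
lra.
Unshelve. all: by end_near.
Qed.
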